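(* Let $X$ be a Tychonoff space such that $C_k(X)$ is a Fréchet locally convex space. Then $C_k(X)$ endowed with its weak topology (as a locally convex space) is an Ascoli space if and only if $X$ is countable and discrete.
   Context: A Fréchet locally convex space is a metrizable and complete locally convex space. For a topological space $Z$, $C_k(Z)$ denotes the space of all continuous functions $Z\to\mathbb{R}$ endowed with the compact-open topology. A subset $\mathcal{K}\subset C_k(Z)$ is evenly continuous if the evaluation map $(z,f)\mapsto f(z)$ restricted to $Z\times\mathcal{K}$ is jointly continuous, i.e. for every $z\in Z$, every $f\in\mathcal{K}$ and every neighborhood $O$ of $f(z)$ in $\mathbb{R}$ there are neighborhoods $U_f\subset\mathcal{K}$ of $f$ (in $\mathcal{K}$) and $O_z\subset Z$ of $z$ such that $g(y)\in O$ for all $g\in U_f$, $y\in O_z$. A Tychonoff space $Z$ is called an Ascoli space if every compact subset of $C_k(Z)$ is evenly continuous. Countable means finite or countably infinite. *)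

(* Defs.v *)
From HB Require Import structures.
From mathcomp Require Import all_boot all_order all_algebra.
From mathcomp Require Import interval_inference ring lra.
From mathcomp Require Import all_classical all_reals all_analysis.
Import Order.TTheory GRing.Theory Num.Theory.
Import numFieldNormedType.Exports.

Set Implicit Arguments.
Unset Strict Implicit.
Unset Printing Implicit Defensive.

Local Open Scope classical_set_scope.
Local Open Scope ring_scope.
Local Open Scope convex_scope.

Definition discrete_space (T : topologicalType) : Prop :=
  forall A : set T, open A.

Definition tychonoff_space (T : topologicalType) : Prop :=
  completely_regular_space T /\ hausdorff_space T.

Definition metrizable_space (R : realType) (T : topologicalType) : Prop :=
  exists mT : Metric R T, forall x : T, @nbhs _ (Metric.Pack mT) x = nbhs x.

(* A [tvsType] carries a uniformity that its axioms do not relate to the vector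
   space structure, so the Cauchy condition is stated through the
   neighborhoods of 0. *)
Definition tvs_cauchy (R : realType) (E : tvsType R) (F : set_system E) : Prop :=
  forall U : set E, nbhs 0 U ->
    exists2 A : set E, F A & forall x y, A x -> A y -> U (x - y).

Definition tvs_complete (R : realType) (E : tvsType R) : Prop :=
  forall F : set_system E, ProperFilter F -> tvs_cauchy F ->
    exists x : E, F --> x.

(* Local convexity is part of [tvsType]. *)
Definition frechet_space (R : realType) (E : tvsType R) : Prop :=
  metrizable_space R E /\ tvs_complete E.

Definition topological_dual (R : realType) (E : tvsType R) : Type :=
  {phi : {linear E -> R^o} | continuous phi}.

Definition weak_space (R : realType) (E : tvsType R) : Type :=
  sup_topology (fun phi : topological_dual E =>
    Topological.class (initial_topology (sval phi : E -> R^o))).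

HB.instance Definition _ (R : realType) (E : tvsType R) :=
  Topological.copy (weak_space E)
    (sup_topology (fun phi : topological_dual E =>
      Topological.class (initial_topology (sval phi : E -> R^o)))).

Definition Ck (R : realType) (X : topologicalType) : Type :=
  continuousType X R.

Definition Ck_fun (R : realType) (X : topologicalType) (f : Ck R X) : X -> R :=
  @Continuous.sort X R f.

Coercion Ck_fun : Ck >-> Funclass.

Section Ck_structure.
Variables (R : realType) (X : topologicalType).
Implicit Types f g h : Ck R X.

Lemma Ck_continuous f : continuous f.
Proof. by move=> x; exact: (@cts_fun X R (f : continuousType X R) x). Qed.

Lemma CkP f g : f = g <-> (f : X -> R) = g.
Proof. by split=> [->//|fg]; apply/continuousEP => x; exact: (congr1 (@^~ x) fg). Qed.

Definition mkCk (f : X -> R) (cf : continuous f) : Ck R X :=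
  HB.pack_for (continuousType X R) f (@isContinuous.Build X R f cf).

HB.instance Definition _ := Choice.copy (Ck R X) (continuousType X R).

HB.instance Definition _ := Topological.copy (Ck R X)
  (initial_topology (@Ck_fun R X : Ck R X -> {compact-open, X -> R})).

Let cst_ct (r : R) : continuous (fun _ : X => r).
Proof. by move=> x; exact: cvg_cst. Qed.

Let add_ct f g : continuous (fun x => f x + g x).
Proof. by move=> x; apply: cvgD; exact: Ck_continuous. Qed.

Let opp_ct f : continuous (fun x => - f x).
Proof. by move=> x; apply: cvgN; exact: Ck_continuous. Qed.

Let scale_ct (r : R) f : continuous (fun x => r * f x).
Proof. by move=> x; apply: cvgM; [exact: cvg_cst|exact: Ck_continuous]. Qed.

Definition Ck_zero : Ck R X := mkCk (@cst_ct 0).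
Definition Ck_add f g : Ck R X := mkCk (@add_ct f g).
Definition Ck_opp f : Ck R X := mkCk (@opp_ct f).
Definition Ck_scale (r : R) f : Ck R X := mkCk (@scale_ct r f).

Let addA : associative Ck_add.
Proof. by move=> f g h; apply/CkP/funext => x; exact: addrA. Qed.
Let addC : commutative Ck_add.
Proof. by move=> f g; apply/CkP/funext => x; exact: addrC. Qed.
Let add0 : left_id Ck_zero Ck_add.
Proof. by move=> f; apply/CkP/funext => x; exact: add0r. Qed.
Let addN : left_inverse Ck_zero Ck_opp Ck_add.
Proof. by move=> f; apply/CkP/funext => x; exact: addNr. Qed.

HB.instance Definition _ :=
  GRing.isZmodule.Build (Ck R X) addA addC add0 addN.

Let scaleA (a b : R) f : Ck_scale a (Ck_scale b f) = Ck_scale (a * b) f.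
Proof. by apply/CkP/funext => x; exact: mulrA. Qed.
Let scale1 : left_id 1 Ck_scale.
Proof. by move=> f; apply/CkP/funext => x; exact: mul1r. Qed.
Let scaleDr : right_distributive Ck_scale +%R.
Proof. by move=> a f g; apply/CkP/funext => x; exact: mulrDr. Qed.
Let scaleDl f (a b : R) : Ck_scale (a + b) f = Ck_scale a f + Ck_scale b f.
Proof. by apply/CkP/funext => x; exact: mulrDl. Qed.

HB.instance Definition _ :=
  GRing.Zmodule_isLmodule.Build R (Ck R X) scaleA scale1 scaleDr scaleDl.

Lemma Ck_addE f g x : (f + g) x = f x + g x. Proof. by []. Qed.
Lemma Ck_oppE f x : (- f) x = - f x. Proof. by []. Qed.
Lemma Ck_zeroE x : (0 : Ck R X) x = 0. Proof. by []. Qed.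
Lemma Ck_scaleE (r : R) f x : (r *: f) x = r * f x. Proof. by []. Qed.

Lemma nbhs_CkP f (A : set (Ck R X)) : nbhs f A <->
  exists (K : set X) (e : R), [/\ compact K, 0 < e &
    [set g : Ck R X | forall x, K x -> `|f x - g x| < e] `<=` A].
Proof.
split.
  move=> [_ [[B oB <-] /= Bf BA]].
  pose G : set_system (X -> R) := filter_from
    [set Ke : set X * R | compact Ke.1 /\ 0 < Ke.2]
    (fun Ke => [set g | forall x, Ke.1 x -> `|f x - g x| < Ke.2]).
  have FG : Filter G.
    apply: filter_from_filter.
      by exists (set0, 1); split => //=; exact: compact0.
    move=> [K e] [L d] [/= cK e0] [/= cL d0].
    exists (K `|` L, Num.min e d); first by split; [exact: compactU|rewrite /= lt_min e0].
    move=> g /= gKL; split => x xK.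
      by have := gKL x (or_introl xK); rewrite lt_min => /andP[].
    by have := gKL x (or_intror xK); rewrite lt_min => /andP[].
  have : {compact-open, G --> (f : X -> R)}.
    apply/compact_open_fam_compactP; first exact: Ck_continuous.
    apply/fam_cvgP => K cK P /uniform_nbhs[E [entE EP]].
    move: entE; rewrite -entourage_ballE => -[e /= e0 eE].
    exists (K, e) => //= g gK; apply: EP => /= x Kx.
    by apply: eE => /=; exact: gK.
  move=> /(_ B)[|[K e] [/= cK e0] KB].
    by rewrite nbhsE; exists B.
  by exists K, e; split=> // g /KB; exact: BA.
move=> [K [e [cK e0 KA]]].
have ctf : continuous (@Ck_fun R X : Ck R X -> {compact-open, X -> R}).
  exact: initial_continuous.
apply: filterS KA _.
pose N : set_system (X -> R) := nbhs (Ck_fun f : {compact-open, X -> R}).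
have : {compact-open, N --> (f : X -> R)} by [].
move/(compact_open_fam_compactP (@Ck_continuous f)) => NF.
have := @fam_nbhs X R compact K [set xy | ball xy.1 e xy.2] f
  (@entourage_ball R R (PosNum e0)) cK.
by move=> /NF /ctf.
Qed.

Let Ck_add_continuous :
  continuous (fun z : Ck R X * Ck R X => z.1 + z.2).
Proof.
move=> [f g] A /nbhs_CkP[K [e [cK e0 KA]]].
have e20 : 0 < e / 2 by rewrite divr_gt0.
exists ([set h : Ck R X | forall x, K x -> `|f x - h x| < e / 2],
        [set h : Ck R X | forall x, K x -> `|g x - h x| < e / 2]).
  by split => /=; [apply/(nbhs_CkP f)|apply/(nbhs_CkP g)]; exists K, (e / 2); split.
move=> [h k] /= [hf kg]; apply: KA => x Kx /=.
change (`|f x + g x - (h x + k x)| < e).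
rewrite opprD addrACA (splitr e).
by rewrite (le_lt_trans (ler_normD _ _))// ltrD// ?hf ?kg.
Qed.

Let Ck_scale_continuous :
  continuous (fun z : R^o * Ck R X => z.1 *: z.2).
Proof.
move=> [r f] A /nbhs_CkP[K [e [cK e0 KA]]].
have [M M0 fM] : exists2 M : R, 0 < M & forall x, K x -> `|f x| <= M.
  have cfK : compact (f @` K).
    by apply: continuous_compact => //; apply: continuous_subspaceT => x;
      exact: Ck_continuous.
  have [M [_ HM]] := compact_bounded cfK.
  exists (`|M| + 1); first by rewrite ltr_wpDl.
  move=> x Kx; apply: (HM (`|M| + 1)); last by exists x.
  by rewrite (le_lt_trans (ler_norm _))// ltrDl.
pose d := Num.min 1 (e / (2 * M)).
have d0 : 0 < d by rewrite lt_min ltr01 divr_gt0// mulr_gt0.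
pose c := e / (2 * (`|r| + 1)).
have r0 : 0 < `|r| + 1 by rewrite ltr_wpDl.
have c0 : 0 < c by rewrite divr_gt0// mulr_gt0.
exists ([set s : R^o | `|r - s| < d],
        [set h : Ck R X | forall x, K x -> `|f x - h x| < c]).
  split; last by apply/(nbhs_CkP f); exists K, c; split.
  by apply/(@nbhs_ballP R R^o); exists d => //.
move=> [s h] /= [rs fh]; apply: KA => x Kx /=.
change (`|r * f x - s * h x| < e).
have -> : r * f x - s * h x = (r - s) * f x + s * (f x - h x).
  by rewrite mulrBl mulrBr addrA subrK.
rewrite (le_lt_trans (ler_normD _ _))// !normrM (splitr e).
apply: ler_ltD.
  rewrite (@le_trans _ _ (d * M))//.
    by rewrite ler_pM// ?fM// ltW.
  rewrite (@le_trans _ _ (e / (2 * M) * M))//.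
    by rewrite ler_wpM2r ?(ltW M0)// ge_min lexx orbT.
  by rewrite invfM mulrA mulfVK// gt_eqF.
have sr : `|s| < `|r| + 1.
  rewrite -(subrK r s) (le_lt_trans (ler_normD _ _))// addrC ltrD2l distrC.
  by rewrite (lt_le_trans rs)// ge_min lexx.
rewrite (@le_lt_trans _ _ ((`|r| + 1) * `|f x - h x|))//.
  by rewrite ler_wpM2r// ltW.
rewrite (@lt_le_trans _ _ ((`|r| + 1) * c))//.
  by rewrite ltr_pM2l// fh.
by rewrite /c invfM [e * _]mulrA mulrCA mulfV ?mulr1// gt_eqF.
Qed.

Let Ck_locally_convex : exists2 B : set_system (Ck R X),
  (forall b, b \in B -> convex_set b) & basis B.
Proof.
exists [set b | exists (f : Ck R X) (K : set X) (e : R), [/\ compact K, 0 < e &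
    b = [set g : Ck R X | forall x, K x -> `|f x - g x| < e]]].
  move=> b /[!inE] -[f [K [e [cK e0 ->]]]].
  apply/convex_setW => g h; rewrite !inE /= => fg fh l l0 l1.
  rewrite inE /= => x Kx.
  have -> : f x - (g <| l |> h) x =
      l%:num * (f x - g x) + (1 - l%:num) * (f x - h x).
    have -> : (g <| l |> h) x = l%:num * g x + (1 - l%:num) * h x by [].
    ring.
  rewrite (le_lt_trans (ler_normD _ _))// !normrM.
  rewrite (@ger0_norm _ l%:num)// (@ger0_norm _ (1 - l%:num)) ?subr_ge0//.
  have -> : e = l%:num * e + (1 - l%:num) * e by ring.
  by rewrite ltrD// ltr_pM2l// ?subr_gt0// ?fg ?fh.
split=> [b [f [K [e [cK e0 ->]]]]|f A /nbhs_CkP[K [e [cK e0 KA]]]].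
  rewrite openE => g /= fg; apply/nbhs_CkP.
  have [->|/set0P K0] := eqVneq K set0.
    by exists set0, 1; split=> //; [exact: compact0|move=> h _ x []].
  have ctfg : {within K, continuous (fun x => `|f x - g x|)}.
    apply: continuous_subspaceT => x; apply: cvg_norm; apply: cvgB;
      exact: Ck_continuous.
  have [c Kc cmax] := compact_EVT_max K0 cK ctfg.
  exists K, (e - `|f c - g c|); split => //.
    by rewrite subr_gt0 fg// -in_setE.
  move=> h /= gh x Kx; rewrite -(subrKA (g x)).
  rewrite (le_lt_trans (ler_normD _ _))//.
  have := cmax x; rewrite inE => /(_ Kx) le1; have := gh x Kx; lra.
exists [set g : Ck R X | forall x, K x -> `|f x - g x| < e] => //.
split; first by exists f, K, e.
by move=> x Kx /=; rewrite subrr normr0.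
Qed.

(* The factory [PreTopologicalLmod_isTvs] only builds the translation-invariant
   uniformity; the remaining mixins of [tvsType] have to be added. *)
HB.instance Definition _ := PreTopologicalLmod_isTvs.Build R (Ck R X)
  Ck_add_continuous Ck_scale_continuous Ck_locally_convex.
HB.instance Definition _ :=
  PreTopologicalNmodule_isTopologicalNmodule.Build (Ck R X) Ck_add_continuous.
HB.instance Definition _ :=
  TopologicalNmodule_isTopologicalLmodule.Build R (Ck R X) Ck_scale_continuous.
HB.instance Definition _ :=
  Uniform_isTvs.Build R (Ck R X) Ck_locally_convex.

End Ck_structure.

Definition evenly_continuous (R : realType) (Z : topologicalType)
    (K : set (Ck R Z)) : Prop :=
  forall (z : Z) (f : Ck R Z) (O : set R), K f -> nbhs (f z) O ->
    exists (U : set (Ck R Z)) (V : set Z), [/\ nbhs f U, nbhs z V &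
      forall g y, K g -> U g -> V y -> O (g y)].

Definition ascoli_space (R : realType) (Z : topologicalType) : Prop :=
  tychonoff_space Z /\
  forall K : set (Ck R Z), compact K -> evenly_continuous K.

(* Main.v *)
Require Import Defs.
From HB Require Import structures.
From mathcomp Require Import all_boot all_order all_algebra.
From mathcomp Require Import ring lra.
From mathcomp Require Import all_classical all_reals all_analysis.
Import Order.TTheory GRing.Theory Num.Theory.
Import numFieldNormedType.Exports.

Set Implicit Arguments.
Unset Strict Implicit.
Unset Printing Implicit Defensive.

Local Open Scope classical_set_scope.
Local Open Scope ring_scope.

(** Write E for C_k(X) and E_w for E with its weak topology.

    If X is discrete, its compact sets are finite, so the topology of E is that
    of pointwise convergence, which is also the weak one
    ([discrete_weak_nbhsE]). As E is metrizable, E_w is first countable, and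
    over a first countable space every compact set of continuous functions is
    equicontinuous, hence evenly continuous
    ([first_countable_evenly_continuous]).

    Conversely, suppose that E_w is Ascoli. The heart of the proof is that the
    compact subsets of X are finite ([weak_ascoli_compact_finite]). An infinite
    compact set C would contain points x_k carrying continuous functions
    e_k >= 0 with e_k(x_k) = 1 and sum_k e_k <= 1 ([infinite_set_peaks]). The
    e_k behave like the unit vectors of c_0: sum_k |phi(e_k)| is finite for each
    phi in the dual ([peaks_dual_summable]), and counting then shows that 0 is a
    weak cluster point of the vectors n e_k with k < n^2
    ([weak_peaks_cluster]). On the other hand a weakly compact subset of E is
    uniformly bounded on C ([weak_compact_bounded], a form of the
    Banach-Steinhaus theorem), so the weakly continuous functions
    F_(n,k) : f |-> max(0, f(x_k) - (n - 1)), for k < n^2, vanish on any given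
    weakly compact set as soon as n is large. Together with 0 they therefore
    form a compact subset of C_k(E_w), and F_(n,k)(n e_k) = 1 contradicts even
    continuity at (0, 0).

    Once the compact subsets of X are finite, completeness of E makes every
    indicator function of a point continuous, so that X is discrete
    ([complete_compact_finite_discrete]), and metrizability of E makes X a
    countable union of compact, hence finite, sets
    ([metrizable_compact_finite_countable]). *)

(** * Compactness and even continuity *)

(** A set is compact as soon as it has a point whose neighborhoods all contain
    all but finitely many of its elements, for instance the range of a
    convergent sequence together with the limit. *)
Lemma compact_cofinite_nbhs (T : topologicalType) (K : set T) (l : T) :
  K l -> (forall U, nbhs l U -> finite_set (K `\` U)) -> compact K.
Proof.
move=> Kl Kfin F FF FK; have [Fl|] := pselect (cluster F l); first by exists l.
rewrite /cluster /meets /= => /existsNP[A] /existsNP[U] /not_implyP[FA].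
move=> /not_implyP[lU AU0].
have FKU : F (K `\` U).
  apply: filterS (filterI FK FA) => x [Kx Ax]; split => // Ux.
  by apply: AU0; exists x.
have [x [[Kx _] Fx]] := finite_compact (Kfin _ lU) FF FKU.
by exists x; split.
Qed.

Lemma discrete_compact_finite (X : topologicalType) (C : set X) :
  discrete_space X -> compact C -> finite_set C.
Proof.
move=> discX cC; apply: contrapT => infC.
(* the complements in [C] of the finite sets form a filter without cluster
   point *)
pose F := filter_from finite_set (fun D => C `\` D).
have FF : ProperFilter F.
  apply: filter_from_proper; first apply: filter_from_filter.
  - by exists set0.
  - move=> D1 D2 fD1 fD2; exists (D1 `|` D2); first by rewrite finite_setU.
    by rewrite setDUr.
  - by move=> D fD; exact/infinite_setN0/infinite_setD.
have [|p [_ Fp]] := cC F FF; first by exists set0; rewrite ?setD0.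
have FCp : F (C `\ p) by exists [set p].
have pp : nbhs p [set p] by apply: open_nbhs_nbhs; split => //; exact: discX.
by have [q [[_ qp] /qp]] := Fp _ _ FCp pp.
Qed.

Lemma metrizable_first_countable (R : realType) (T : topologicalType) (z : T) :
  metrizable_space R T -> exists V : nat -> set T, (forall n, nbhs z (V n)) /\
    forall U, nbhs z U -> exists N, forall n, (N <= n)%N -> V n `<=` U.
Proof.
move=> [mT nbhsE]; pose M := Metric.Pack mT.
exists (fun n => @ball R M z n.+1%:R^-1); split => [n|U].
  by rewrite -nbhsE; exact: (@nbhsx_ballx R M).
rewrite -nbhsE => /(@nbhs_ballP R M)[d /= d0 dU].
exists (Num.bound d^-1) => n Nn y zy; apply: dU.
apply: (@le_ball R M) zy; rewrite invf_ple ?posrE// ltW//.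
have dV0 : 0 <= d^-1 by rewrite invr_ge0 ltW.
by rewrite (lt_le_trans (archi_boundP dV0))// ler_nat leqW.
Qed.

(** The easy half of the Ascoli theorem: if equicontinuity at [z] failed, it
    would fail at points [y_n] converging to [z], and uniform convergence on
    the compact set [S] formed by [z] and the [y_n] is incompatible with
    this. *)
Lemma first_countable_evenly_continuous (R : realType) (Z : topologicalType)
    (K : set (Ck R Z)) :
  (forall z : Z, exists V : nat -> set Z, (forall n, nbhs z (V n)) /\
    forall U, nbhs z U -> exists N, forall n, (N <= n)%N -> V n `<=` U) ->
  compact K -> evenly_continuous K.
Proof.
move=> fcZ cK z f O Kf Ofz; have [V [zV Vz]] := fcZ z.
have /nbhs_ballP[e /= e0 eO] := Ofz.
have e40 : 0 < e / 4 by rewrite divr_gt0.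
have [n equi] : exists n, forall g y, K g -> V n y -> `|g z - g y| < e / 2.
  apply: contrapT => /forallNP noequi.
  have /choice[gy gyP] : forall n, exists gy : Ck R Z * Z,
      [/\ K gy.1, V n gy.2 & e / 2 <= `|gy.1 z - gy.1 gy.2|].
    move=> n; have /existsNP[g /existsNP[y]] := noequi n.
    move=> /not_implyP[Kg] /not_implyP[Vy] /negP; rewrite -leNgt => h.
    by exists (g, y).
  pose S := z |` range (fun n => (gy n).2).
  have cS : compact S.
    apply: (@compact_cofinite_nbhs _ S z); first by left.
    move=> U zU; have [N NU] := Vz _ zU.
    apply: (@sub_finite_set _ _ ((fun n => (gy n).2) @` `I_N)).
      move=> _ [[->|[n _ <-]] nUy]; first by have := nbhs_singleton zU.
      exists n => //=; rewrite ltnNge; apply/negP => Nn; apply: nUy.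
      by apply: (NU _ Nn); have [] := gyP n.
    exact/finite_image/finite_II.
  have [|g [Kg gcl]] := cK ((fun n => (gy n).1) @ \oo) _ _.
    by exists 0%N => // n _ /=; have [] := gyP n.
  have [N NV] : exists N, forall n, (N <= n)%N -> V n `<=`
      [set y | `|g z - g y| < e / 4].
    by apply: Vz; have /cvgrPdist_lt := @Ck_continuous R Z g z; apply.
  (* [g] is a cluster point of the chosen functions: one of them, with index
     at least [N], is uniformly close to [g] on the compact set [S] *)
  have [_ [[n Nn <-] gn]] := gcl
    ((fun n => (gy n).1) @` [set n | (N <= n)%N])
    [set h : Ck R Z | forall x, S x -> `|g x - h x| < e / 8]
    (ex_intro2 _ _ N I (fun n Nn => ex_intro2 _ _ n Nn erefl))
    (proj2 (nbhs_CkP _ _) (ex_intro _ S (ex_intro _ (e / 8)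
      (And3 cS (divr_gt0 e0 (ltr0n _ 8)) (@subset_refl _ _))))).
  have [_ Vn] := gyP n; apply/negP; rewrite -ltNge.
  have h1 := gn z (or_introl erefl).
  have h2 := gn (gy n).2 (or_intror (ex_intro2 _ _ n I erefl)).
  have h3 := NV _ Nn _ Vn; rewrite /= in h3.
  move: h1 h2 h3; rewrite !ltr_norml => /andP[? ?] /andP[? ?] /andP[? ?].
  by apply/andP; split; lra.
exists [set g | forall x, [set z] x -> `|f x - g x| < e / 2], (V n).
split => //.
  apply/nbhs_CkP; exists [set z], (e / 2).
  split => //; first exact: compact_set1.
  by rewrite divr_gt0.
move=> g y Kg /(_ z erefl) fgz Vy; apply: eO; rewrite /ball /=.
have := equi g y Kg Vy; move: fgz.
by rewrite !ltr_norml => /andP[? ?] /andP[? ?]; apply/andP; split; lra.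
Qed.

(** * Continuous functions on a Tychonoff space *)

Lemma continuous_pospart (R : realType) (T : topologicalType) (f : T -> R) :
  continuous f -> continuous (fun x => Num.max 0 (f x)).
Proof.
move=> cf x; under eq_fun do rewrite maxr_absE.
apply: cvgM; last exact: cvg_cst; apply: cvgD.
  by apply: cvgD; [exact: cvg_cst|exact: cf].
by apply: cvg_norm; apply: cvgB; [exact: cvg_cst|exact: cf].
Qed.

Lemma continuous_pospart_sub (R : realType) (T : topologicalType) (f : T -> R)
  (c : R) : continuous f -> continuous (fun x => Num.max 0 (f x - c)).
Proof.
by move=> cf; apply: continuous_pospart => x; apply: cvgB;
  [exact: cf|exact: cvg_cst].
Qed.

Lemma mkCkE (R : realType) (X : topologicalType) (f : X -> R)
  (cf : continuous f) (x : X) : Ck_fun (mkCk cf) x = f x.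
Proof. by []. Qed.

(** Evaluation of linear combinations. The projection [Ck_fun] is written out
    because the coercion to functions, applied to a term that comes from the
    vector space structure, may elaborate to another, convertible head. *)
Lemma Ck_funB (R : realType) (X : topologicalType) (f g : Ck R X) (x : X) :
  Ck_fun (f - g) x = f x - g x.
Proof. by []. Qed.

Lemma Ck_funZ (R : realType) (X : topologicalType) (a : R) (f : Ck R X)
  (x : X) :
  Ck_fun (a *: f) x = a * f x.
Proof. by []. Qed.

Lemma Ck_fun0 (R : realType) (X : topologicalType) (x : X) :
  Ck_fun (0 : Ck R X) x = 0.
Proof. by []. Qed.

Lemma Ck_fun_sum (R : realType) (X : topologicalType) (I : Type) (r : seq I)
  (F : I -> Ck R X) (x : X) :
  Ck_fun (\sum_(i <- r) F i) x = \sum_(i <- r) F i x.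
Proof.
exact: (big_morph (fun f : Ck R X => Ck_fun f x) (fun f g => erefl) erefl).
Qed.

Section tychonoff.
Variables (R : realType) (X : topologicalType).
Hypothesis tychX : tychonoff_space X.

Lemma tychonoff_separation (a : X) (B : set X) : closed B -> ~ B a ->
  exists f : Ck R X, [/\ f a = 1, forall x, B x -> f x = 0 &
    forall x, 0 <= f x <= 1].
Proof.
have [crX _] := tychX => cB nBa.
have /(@uniform_separatorP _ R)[f [cf f01 fa fB]] := crX a B cB nBa.
have cg : continuous (fun x => 1 - f x).
  by move=> x; apply: cvgB; [exact: cvg_cst|exact: cf].
exists (mkCk cg); split => [|x Bx|x]; rewrite /Ck_fun /=.
- by rewrite (fa (f a)) ?subr0//; exists a.
- by rewrite (fB (f x)) ?subrr//; exists x.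
- have /f01 : range f (f x) by exists x.
  by rewrite /= in_itv /= => /andP[? ?]; apply/andP; split; lra.
Qed.

Lemma tychonoff_finite_closed (K : set X) : finite_set K -> closed K.
Proof.
by move: K; apply/accessible_finite_set_closed/hausdorff_accessible;
  have [] := tychX.
Qed.

Lemma infinite_split_peak (A : set X) : infinite_set A ->
  exists (a : X) (g : Ck R X), [/\ A a, g a = 1, forall x, 0 <= g x <= 1 &
    infinite_set (A `&` [set x | g x = 0])].
Proof.
move=> infA; have [a Aa] := infinite_setN0 infA.
have [b [Ab nba]] : (A `\ a) !=set0.
  exact/infinite_setN0/infinite_setD.
have [h [h1 h0 h01]] := tychonoff_separation
  (tychonoff_finite_closed (finite_set1 b)) (nesym nba).
(* [h] separates two points [a], [b] of [A]; one of the sets [h <= 1/2] and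
   [1/2 <= h] contains infinitely many points of [A], and the ramp that
   vanishes there equals 1 at [a] or at [b] *)
have cu : continuous (fun x => Num.max 0 (2 * h x - 1)).
  apply: continuous_pospart => x; apply: cvgB; last exact: cvg_cst.
  by apply: cvgM; [exact: cvg_cst|exact: Ck_continuous].
have cv : continuous (fun x => Num.max 0 (1 - 2 * h x)).
  apply: continuous_pospart => x; apply: cvgB; first exact: cvg_cst.
  by apply: cvgM; [exact: cvg_cst|exact: Ck_continuous].
have [infu|finu] := pselect (infinite_set (A `&` [set x | mkCk cu x = 0])).
  exists a, (mkCk cu); split => //.
    by rewrite mkCkE h1 mulr1 max_r//; lra.
  move=> x; have /andP[? ?] := h01 x; rewrite mkCkE le_max lexx/=.
  by rewrite ge_max ler01/=; lra.
exists b, (mkCk cv); split => //.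
- by rewrite mkCkE (h0 b erefl) mulr0 max_r//; lra.
- move=> x; have /andP[? ?] := h01 x.
  by rewrite mkCkE le_max lexx/= ge_max ler01/=; lra.
move=> finv; apply: infA.
have finU := conj (contrapT finu) finv; rewrite -finite_setU in finU.
apply: sub_finite_set finU => x Ax.
have [hx|hx] := leP (h x) (1 / 2); [left|right];
  (split; first exact: Ax); apply: max_l; lra.
Qed.

(** Peaks at infinitely many points of [A]. If each [g_k] has values in [0, 1],
    equals 1 at [x_k] and vanishes at the later points, the functions
    [e_k = g_k * \prod_(j < k) (1 - g_j)] have the telescoping partial sums
    [1 - \prod_(k < N) (1 - g_k)]. Pairwise disjoint supports are not needed. *)
Lemma infinite_set_peaks (A : set X) : infinite_set A ->
  exists (x : nat -> X) (e : nat -> Ck R X), [/\ forall k, A (x k),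
    forall k, e k (x k) = 1, forall k y, 0 <= e k y &
    forall N y, \sum_(k < N) e k y <= 1].
Proof.
move=> infA.
have /choice[s sP] : forall B : set X, exists ag : X * Ck R X, infinite_set B ->
    [/\ B ag.1, ag.2 ag.1 = 1, forall x, 0 <= ag.2 x <= 1 &
      infinite_set (B `&` [set x | ag.2 x = 0])].
  move=> B; have [/infinite_split_peak[a [g P]]|nB] := pselect (infinite_set B).
    by exists (a, g).
  by have [a _] := infinite_setN0 infA; exists (a, 0).
pose As := fix As n := if n is m.+1 then As m `&` [set x | (s (As m)).2 x = 0]
  else A.
have infAs n : infinite_set (As n).
  by elim: n => // n /sP[].
pose x n := (s (As n)).1; pose g n := (s (As n)).2.
have Asx n : As n (x n) by have [] := sP _ (infAs n).
have gx1 n : g n (x n) = 1 by have [] := sP _ (infAs n).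
have g01 n y : 0 <= g n y <= 1 by have [] := sP _ (infAs n).
have AsA m n : (m <= n)%N -> As n `<=` As m.
  elim: n => [|n ih]; first by rewrite leqn0 => /eqP ->.
  by rewrite leq_eqVlt => /predU1P[->//|/ih h y [/h]].
have gx0 m n : (m < n)%N -> g m (x n) = 0.
  by move=> /AsA/(_ _ (Asx n))[].
pose q := fix q n := if n is m.+1 then (fun y => q m y * (1 - g m y))
  else (fun _ : X => 1).
have qprod n y : q n y = \prod_(j < n) (1 - g j y).
  by elim: n => [|n /= ->]; rewrite ?big_ord0// big_ord_recr.
have cq n : continuous (q n).
  elim: n => [|n ih] y /=; first exact: cvg_cst.
  apply: cvgM; first exact: ih.
  by apply: cvgB; [exact: cvg_cst|exact: Ck_continuous].
have q0 n y : 0 <= q n y.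
  elim: n => //= n ih; rewrite mulr_ge0//.
  by have /andP[? ?] := g01 n y; rewrite subr_ge0.
have ce n : continuous (fun y => g n y * q n y).
  by move=> y; apply: cvgM; [exact: Ck_continuous|exact: cq].
exists x, (fun n => mkCk (ce n)); split.
- by move=> k; apply: (AsA 0%N k).
- move=> k; rewrite mkCkE gx1 mul1r qprod big1// => j _.
  by rewrite gx0 ?subr0.
- by move=> k y; have /andP[? ?] := g01 k y; rewrite mulr_ge0.
- move=> N y; suff -> : \sum_(k < N) mkCk (ce k) y = 1 - q N y.
    by rewrite lerBlDr lerDl.
  elim: N => [|N ih]; first by rewrite big_ord0 /= subrr.
  by rewrite big_ord_recr ih mkCkE /=; ring.
Qed.

End tychonoff.

(** * The dual of the space of continuous functions *)

Section dual.
Variables (R : realType) (X : topologicalType).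

Lemma Ck_compact_bounded (f : Ck R X) (C : set X) : compact C ->
  exists2 M : R, 0 < M & forall x, C x -> `|f x| <= M.
Proof.
move=> cC; have cfC : compact (f @` C).
  by apply: continuous_compact => //; apply: continuous_subspaceT => x;
    exact: Ck_continuous.
have [M [_ HM]] := compact_bounded cfC.
exists (`|M| + 1); first by rewrite ltr_wpDl.
move=> x Cx; apply: (HM (`|M| + 1)); last by exists x.
by rewrite (le_lt_trans (ler_norm _))// ltrDl.
Qed.

Lemma Ck_dual_bounded (phi : topological_dual (Ck R X)) :
  exists (C : set X) (M : R), compact C /\
    forall f : Ck R X, (forall x, C x -> `|f x| <= 1) -> `|sval phi f| <= M.
Proof.
case: phi => phi' cphi /=.
have /cvgrPdist_lt/(_ 1 ltr01) := cphi 0.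
move=> /nbhs_CkP[C [e [cC e0 Ce]]]; exists C, (2 / e); split => // f f1.
have e20 : 0 < e / 2 by rewrite divr_gt0.
have : `|phi' 0 - phi' ((e / 2) *: f)| < 1.
  apply: Ce => x Cx; rewrite Ck_fun0 sub0r normrN Ck_funZ normrM gtr0_norm//.
  by have := ler_wpM2l (ltW e20) (f1 x Cx); lra.
rewrite linear0 sub0r normrN linearZ/= normrM gtr0_norm// => /ltW.
by rewrite -ler_pdivlMl// mulr1 invf_div.
Qed.

Lemma Ck_linear_continuous (phi : {linear Ck R X -> R^o}) (C : set X) (M : R) :
  compact C ->
  (forall (f : Ck R X) e,
    (forall x, C x -> `|f x| <= e) -> `|phi f| <= M * e) ->
  continuous phi.
Proof.
move=> cC phiM f A /nbhs_ballP[e /= e0 eA].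
pose d := e / (`|M| + 1).
have M0 : 0 < `|M| + 1 by rewrite ltr_wpDl.
have d0 : 0 < d by rewrite divr_gt0.
apply/nbhs_CkP; exists C, d; split => // g gf /=.
apply: eA; rewrite /ball/= -linearB (le_lt_trans (phiM (f - g) d _))//.
  by move=> x Cx; exact/ltW/gf.
rewrite (@lt_le_trans _ _ ((`|M| + 1) * d))// ?ltr_pM2r//.
  by rewrite (le_lt_trans (ler_norm _))// ltrDl.
by rewrite mulrC divfK// gt_eqF.
Qed.

(** An absolutely summable combination of evaluations at points of a compact
    set is a continuous linear functional. *)
Lemma summable_evaluations (C : set X) (y : nat -> X) (c : nat -> R) :
  compact C -> (forall j, C (y j)) -> cvgn [normed series c] ->
  exists phi : topological_dual (Ck R X), forall f : Ck R X,
    series (fun j => c j * f (y j)) @ \oo --> (sval phi f : R).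
Proof.
move=> cC Cy cvc.
have normle (f : Ck R X) e : (forall x, C x -> `|f x| <= e) ->
    forall j, `|c j * f (y j)| <= e * `|c j|.
  by move=> fe j; rewrite normrM mulrC ler_wpM2r// fe.
have cvce e : cvgn (series (fun j => e * `|c j|)).
  have -> : series (fun j => e * `|c j|) = (fun n => e * [normed series c] n).
    by apply/funext => n; rewrite /series/= mulr_sumr.
  exact: is_cvgZr.
have ncv (f : Ck R X) : cvgn [normed series (fun j => c j * f (y j))].
  have [M M0 fM] := Ck_compact_bounded f cC.
  apply: (@series_le_cvg _ _ (fun j => M * `|c j|)) => [n|n|n|].
  - exact: normr_ge0.
  - by apply: mulr_ge0; [exact: ltW|exact: normr_ge0].
  - exact: normle.
  - exact: cvce.
have cv (f : Ck R X) : cvgn (series (fun j => c j * f (y j))).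
  exact: (@normed_cvg R R^o).
pose phi (f : Ck R X) : R^o := limn (series (fun j => c j * f (y j))).
have linphi (a : R) (f g : Ck R X) : phi (a *: f + g) = a *: phi f + phi g.
  apply: (@cvg_lim R^o) => //.
  have -> : series (fun j => c j * Ck_fun (a *: f + g) (y j)) = (fun n =>
      a * series (fun j => c j * f (y j)) n +
      series (fun j => c j * g (y j)) n).
    apply/funext => n; rewrite /series/= mulr_sumr -big_split/=.
    by apply: eq_bigr => j _; rewrite -mulrCA -mulrDr.
  by apply: cvgD; [apply: cvgZr; exact: cv|exact: cv].
pose phiL : {linear Ck R X -> R^o} :=
  HB.pack phi (GRing.isLinear.Build R (Ck R X) R^o *:%R phi linphi).
have cphi : continuous phiL.
  apply: (@Ck_linear_continuous phiL C (limn [normed series c])) => // f e fe.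
  apply: (le_trans (@lim_series_norm R R^o _ (ncv f))).
  have -> : limn [normed series c] * e = limn (series (fun j => e * `|c j|)).
    apply/esym/(@cvg_lim R^o) => //.
    have -> : series (fun j => e * `|c j|) = (fun n => [normed series c] n * e).
      by apply/funext => n; rewrite /series/= mulr_suml; apply: eq_bigr => j _;
        rewrite mulrC.
    by apply: cvgZl; exact: cvc.
  by apply: lim_series_le => [||j]; [exact: ncv|exact: cvce|exact: normle].
by exists (exist _ phiL cphi) => f; exact: cv.
Qed.

Lemma evaluation_dual (x : X) :
  exists phi : topological_dual (Ck R X), forall f : Ck R X, sval phi f = f x.
Proof.
have linphi : linear (fun f : Ck R X => f x : R^o) by [].
pose phiL : {linear Ck R X -> R^o} :=
  HB.pack (fun f : Ck R X => f x : R^o)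
    (GRing.isLinear.Build R (Ck R X) R^o *:%R _ linphi).
have cphi : continuous phiL.
  apply: (@Ck_linear_continuous phiL [set x] 1); first exact: compact_set1.
  by move=> f e fe; rewrite mul1r; exact: fe.
by exists (exist _ phiL cphi).
Qed.

Lemma peaks_dual_summable (e : nat -> Ck R X)
    (phi : topological_dual (Ck R X)) :
  (forall k y, 0 <= e k y) -> (forall N y, \sum_(k < N) e k y <= 1) ->
  exists M : R, forall N, \sum_(k < N) `|sval phi (e k)| <= M.
Proof.
move=> e0 e1; have [C [M [cC phiM]]] := Ck_dual_bounded phi.
exists M => N.
(* test [phi] on the signed sum of the peaks, which is bounded by 1 *)
have -> : \sum_(k < N) `|sval phi (e k)| =
    sval phi (\sum_(k < N) Num.sg (sval phi (e k)) *: e k).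
  rewrite linear_sum; apply: eq_bigr => k _; rewrite linearZ/=.
  exact: normrEsg.
apply: le_trans (ler_norm _) (phiM _ _) => x _.
rewrite Ck_fun_sum (le_trans (ler_norm_sum _ _ _))// (le_trans _ (e1 N x))//.
apply: ler_sum => k _; rewrite Ck_funZ normrM (ger0_norm (e0 _ _)).
by rewrite ler_piMl// normr_sg; case: (_ != 0).
Qed.

End dual.

(** * The weak topology *)

Section weak_topology.
Variables (R : realType) (E : tvsType R).

Lemma weak_cvgP (F : set_system E) (x : E) : Filter F ->
  F --> (x : weak_space E) <->
  forall phi : topological_dual E, sval phi @ F --> (sval phi x : R).
Proof.
move=> FF; rewrite cvg_sup; split=> Fx phi.
  by apply: cvg_comp (Fx phi) _; exact: initial_continuous.
move=> A [_ [[B oB <-] Bx BA]]; apply: filterS BA _.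
by apply: Fx; exact: open_nbhs_nbhs.
Qed.

Lemma weak_dual_continuous (phi : topological_dual E) :
  continuous (sval phi : weak_space E -> R).
Proof.
move=> x; have [+ _] := @weak_cvgP (nbhs (x : weak_space E)) x _.
by apply; exact: cvg_id.
Qed.

End weak_topology.

(** One sequence of signs such that, in each row [n] of the array [a], the
    signed sum of the entries of index at most [n] is in absolute value at least
    the last of them. *)
Lemma exists_signs (R : realType) (a : nat -> nat -> R) :
  exists s : nat -> R, (forall n, `|s n| = 1) /\
    forall n, `|a n n| <= `|\sum_(j < n.+1) s j * a n j|.
Proof.
(* [S n] lists the first [n] signs, completed by 1; the sign of index [m]
   makes the last term of row [m] agree in sign with the sum of the terms that
   precede it *)
pose sgn (b : bool) : R := if b then 1 else -1.
pose S := fix S n : nat -> R := if n is m.+1 then fun j =>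
  if j == m then sgn (0 <= (\sum_(i < m) S m i * a m i) * a m m) else S m j
  else fun=> 1.
have SE n j : (j < n)%N -> S n j = S j.+1 j.
  elim: n => // n ih; rewrite ltnS leq_eqVlt => /predU1P[->//|jn].
  by rewrite -ih//= ltn_eqF.
exists (fun j => S j.+1 j); split => [n|n].
  by rewrite /= eqxx /sgn; case: ifP; rewrite ?normrN normr1.
rewrite big_ord_recr (eq_bigr (fun i : 'I_n => S n i * a n i)); last first.
  by move=> i _ /=; rewrite (SE n i).
rewrite /= eqxx.
set u := \sum_(i < n) _; set v := a n n.
have key (w : R) : 0 <= u * w -> `|w| <= `|u + w|.
  move=> uw; rewrite -(@ler_pXn2r _ 2)// ?nnegrE// !real_normK ?num_real//.
  by rewrite !expr2; nra.
rewrite /sgn; case: ifPn => [uv|]; first by rewrite mul1r key.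
by rewrite -ltNge mulN1r -[`|v|]normrN => uv; apply: key; nra.
Qed.

Lemma geometric_third_tail (R : realType) n m :
  \sum_(n.+1 <= j < n.+1 + m) (3^-1 : R) ^+ j <= 1 / 2 * 3^-1 ^+ n.
Proof.
suff -> : \sum_(n.+1 <= j < n.+1 + m) (3^-1 : R) ^+ j =
    1 / 2 * (3^-1 ^+ n - 3^-1 ^+ (n + m)).
  by rewrite ler_pM2l// lerBlDr lerDl exprn_ge0.
elim: m => [|m ih]; first by rewrite !addn0 big_geq// subrr mulr0.
by rewrite addnS big_nat_recr ?leq_addr//= ih addSn addnS !exprS; field.
Qed.

Section weak_bounded.
Variables (R : realType) (X : topologicalType).

Lemma weak_evaluation_continuous (x : X) :
  continuous (fun f : weak_space (Ck R X) => Ck_fun (f : Ck R X) x).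
Proof.
have [phi phiE] := @evaluation_dual R X x.
have -> : (fun f : weak_space (Ck R X) => Ck_fun (f : Ck R X) x) = sval phi.
  by apply/funext => f; rewrite phiE.
exact: weak_dual_continuous.
Qed.

(** Weakly compact sets are bounded on each compact subset of [X]: a uniform
    boundedness principle, proved by summing evaluations with signs. *)
Lemma weak_compact_bounded (L : set (weak_space (Ck R X))) (C : set X) :
  compact L -> compact C ->
  exists M : R, forall f : Ck R X, L f -> forall x, C x -> `|f x| <= M.
Proof.
move=> cL cC; apply: contrapT => /forallNP unb.
(* [f_n] in [L] is huge on [C] and attains the maximum of its absolute value
   on [C] at [y_n]. The functional with weights [3^-j], suitably signed, at
   the points [y_j] is unbounded on the [f_n]: the signs keep the first n+1
   terms at [f_n] above [3^-n * |f_n(y_n)|], the remaining ones add up to at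
   most half of it *)
have /choice[fy fyP] : forall n : nat, exists fy : Ck R X * X,
    [/\ L fy.1, C fy.2, n%:R * (2 * 3 ^+ n) <= `|fy.1 fy.2| &
      forall x, C x -> `|fy.1 x| <= `|fy.1 fy.2|].
  move=> n; have := unb (n%:R * (2 * 3 ^+ n)).
  move=> /existsNP[f] /not_implyP[Lf] /existsNP[x] /not_implyP[Cx] /negP.
  rewrite -ltNge => ltf.
  have ctf : {within C, continuous (fun x => `|f x|)}.
    by apply: continuous_subspaceT => y; apply: cvg_norm; exact: Ck_continuous.
  have [y] := compact_EVT_max (ex_intro _ x Cx) cC ctf.
  rewrite inE => Cy fy; exists (f, y); split => //=.
    by rewrite (le_trans (ltW ltf))// fy// inE.
  by move=> z Cz; apply: fy; rewrite inE.
pose f n := (fy n).1; pose y n := (fy n).2.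
have [s [s1 sP]] := exists_signs (fun n j => 3^-1 ^+ j * f n (y j)).
have cE j : `|s j * 3^-1 ^+ j| = 3^-1 ^+ j.
  by rewrite normrM s1 mul1r ger0_norm.
have [||phi phiP] :=
  @summable_evaluations R X C y (fun j => s j * 3^-1 ^+ j) cC.
- by move=> j; have [] := fyP j.
- have -> : [normed series (fun j => s j * 3^-1 ^+ j)] =
      series (geometric 1 3^-1).
    by congr series; apply/funext => n; rewrite /= cE mul1r.
  by apply: is_cvg_geometric_series; rewrite ger0_norm//; lra.
have [B LB] : exists B : R, forall g : Ck R X, L g -> `|sval phi g| <= B.
  have cphiL : compact ((sval phi : weak_space (Ck R X) -> R) @` L).
    apply: continuous_compact => //; apply: continuous_subspaceT.
    exact: weak_dual_continuous.
  have [M [_ HM]] := compact_bounded cphiL.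
  exists (`|M| + 1) => g Lg; apply: (HM (`|M| + 1)); last by exists g.
  by rewrite (le_lt_trans (ler_norm _))// ltrDl.
have big n : n%:R <= `|sval phi (f n)|.
  have /cvg_norm phin := phiP (f n).
  apply: (cvgr_to_ge phin); exists n.+1 => // N /= nN.
  have [_ _ fbig fmax] := fyP n; rewrite -/(f n) -/(y n) in fbig fmax.
  rewrite /series/= (big_cat_nat (n := n.+1))//=.
  have head : 3^-1 ^+ n * `|f n (y n)| <=
      `|\sum_(0 <= j < n.+1) s j * 3^-1 ^+ j * f n (y j)|.
    have := sP n; rewrite normrM ger0_norm ?exprn_ge0//; congr (_ <= `|_|).
    by rewrite big_mkord; apply: eq_bigr => j _; rewrite mulrA.
  have tail : `|\sum_(n.+1 <= j < N) s j * 3^-1 ^+ j * f n (y j)| <=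
      1 / 2 * 3^-1 ^+ n * `|f n (y n)|.
    apply: (le_trans (ler_norm_sum _ _ _)).
    apply: (@le_trans _ _ (\sum_(n.+1 <= j < N) 3^-1 ^+ j * `|f n (y n)|)).
      apply: ler_sum => j _; rewrite normrM cE ler_wpM2l ?exprn_ge0//.
      by apply: fmax; have [] := fyP j.
    rewrite -mulr_suml ler_wpM2r// -(subnKC nN).
    exact: geometric_third_tail.
  have half : n%:R <= 1 / 2 * (3^-1 ^+ n * `|f n (y n)|).
    have -> : n%:R = 1 / 2 * (3^-1 ^+ n * (n%:R * (2 * 3 ^+ n))) :> R.
      by rewrite exprVn; field; rewrite expf_neq0.
    by rewrite ler_pM2l// ler_wpM2l// exprn_ge0.
  apply: (le_trans _ (lerB_normD _ _)); lra.
have [n Bn] : exists n : nat, B < n%:R.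
  by exists (Num.bound `|B|); rewrite (le_lt_trans (ler_norm _))// archi_boundP.
have := big n; have [Lfn _ _ _] := fyP n.
by have := LB _ Lfn; rewrite -/(f n); lra.
Qed.

End weak_bounded.

(** * Compact sets of a space with Ascoli weak topology *)

Section weak_ascoli.
Variables (R : realType) (X : topologicalType).
Hypothesis tychX : tychonoff_space X.

(** 0 is a weak cluster point of the vectors [n e_k] with [k < n^2]. *)
Lemma weak_peaks_cluster (e : nat -> Ck R X) (V : set (weak_space (Ck R X)))
    (N : nat) :
  (forall k y, 0 <= e k y) -> (forall n y, \sum_(k < n) e k y <= 1) ->
  nbhs (0 : weak_space (Ck R X)) V ->
  exists n k, [/\ (N <= n)%N, (k < n ^ 2)%N & V (n%:R *: e k : Ck R X)].
Proof.
move=> e0 e1 V0.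
(* [G] is generated by the sets of pairs [(n, k)] with [m <= n], [k < n^2] and
   [n * b_k < 1], where [b] ranges over the summable sequences of nonnegative
   numbers and [m] over the natural numbers *)
pose D := [set bm : (nat -> R) * nat | (forall k, 0 <= bm.1 k) /\
  exists B, forall n, \sum_(k < n) bm.1 k <= B].
pose P (bm : (nat -> R) * nat) := [set nk : nat * nat | [/\ (bm.2 <= nk.1)%N,
  (nk.2 < nk.1 ^ 2)%N & nk.1%:R * bm.1 nk.2 < 1]].
pose G := filter_from D P.
have FG : Filter G.
  apply: filter_from_filter.
    by exists (fun=> 0, 0%N); split => //; exists 0 => n; rewrite big1.
  move=> [b m] [c p] [/= b0 [B bB]] [/= c0 [C cC]].
  exists (fun k => b k + c k, maxn m p).
    split => [k|]; first by rewrite /= addr_ge0.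
    by exists (B + C) => n; rewrite big_split; exact: lerD (bB n) (cC n).
  move=> [n k] [/=]; rewrite geq_max => /andP[mn pn] kn nbc.
  split; split => //=; apply: le_lt_trans nbc; rewrite ler_wpM2l//.
    by rewrite lerDl.
  by rewrite lerDr.
(* if [n * b_k >= 1] for all [k < n^2], then the sum of [b] is at least [n] *)
have PG : ProperFilter G.
  apply: filter_from_proper => -[b m] [/= b0 [B bB]].
  pose n := (maxn m (Num.bound `|B|)).+1.
  have Bn : B < n%:R.
    rewrite (le_lt_trans (ler_norm _))// (lt_le_trans (archi_boundP _))//.
    by rewrite ler_nat; exact/leqW/leq_maxr.
  apply: contrapT => /forallNP nP.
  have bn (k : 'I_(n ^ 2)) : n%:R^-1 <= b k.
    have := nP (n, val k); rewrite /P /= leNgt => nPk.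
    apply/negP => bk; apply: nPk.
    split => //=; first exact/leqW/leq_maxl.
    by rewrite -ltr_pdivlMl ?ltr0n// mulr1.
  have : n%:R <= B.
    apply: le_trans (bB (n ^ 2)%N).
    have -> : n%:R = \sum_(k < n ^ 2) n%:R^-1 :> R.
      rewrite sumr_const card_ord -[RHS]mulr_natl natrX expr2.
      by rewrite mulfK ?pnatr_eq0.
    exact: ler_sum.
  by rewrite leNgt Bn.
(* for [phi] in the dual and [d > 0], use [b_k = |phi(e_k)| / d] *)
have Gcvg : (fun nk : nat * nat => nk.1%:R *: e nk.2) @ G -->
    (0 : weak_space (Ck R X)).
  apply/weak_cvgP => phi; rewrite linear0; apply/cvgrPdist_lt => d d0.
  exists (fun k => `|sval phi (e k)| / d, 0%N).
    split => [k|]; first by rewrite /= divr_ge0// ltW.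
    have [M eM] := peaks_dual_summable phi e0 e1.
    by exists (M / d) => n; rewrite -mulr_suml ler_pM2r ?invr_gt0//; exact: eM.
  move=> [n k] [_ _ /=]; rewrite mulrA ltr_pdivrMr// mul1r => nkd.
  rewrite sub0r normrN linearZ/=.
  by rewrite normrM ger0_norm.
have /(filterI (_ : G [set nk | (N <= nk.1)%N /\ (nk.2 < nk.1 ^ 2)%N])) : G _ :=
  Gcvg _ V0.
case.
  exists (fun=> 0, N); first by split => //; exists 0 => n; rewrite big1.
  by move=> nk [].
move=> bm Dbm PV; have [nk nkP] := @filter_ex _ G _ _ (ex_intro2 _ _ bm Dbm PV).
by exists nk.1, nk.2; have [[]] := nkP.
Qed.

Lemma weak_ascoli_compact_finite :
  ascoli_space R (weak_space (Ck R X)) ->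
  forall C : set X, compact C -> finite_set C.
Proof.
move=> [_ asc] C cC; apply: contrapT => infC.
have [x [e [Cx ex e0 e1]]] := @infinite_set_peaks R X tychX C infC.
pose Z : topologicalType := weak_space (Ck R X).
have cF (n k : nat) : continuous
    (fun f : Z => Num.max 0 (Ck_fun (f : Ck R X) (x k) - (n%:R - 1))).
  exact/continuous_pospart_sub/weak_evaluation_continuous.
pose F (n k : nat) : Ck R Z := mkCk (cF n k).
(* on a weakly compact set [L], the values at the points [x_k] have a common
   bound, so that [F n k] vanishes on [L] for [n] large *)
have FU (U : set (Ck R Z)) : nbhs (0 : Ck R Z) U ->
    exists N, forall n k, (N <= n)%N -> U (F n k).
  move=> /nbhs_CkP[L [d [cL d0 LU]]].
  have [M LM] := weak_compact_bounded cL cC.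
  exists (Num.bound `|M|).+1 => n k Nn; apply: LU => f Lf.
  rewrite Ck_fun0 mkCkE max_l ?subrr ?normr0// subr_le0.
  rewrite (le_trans (ler_norm _))// (le_trans (LM f Lf _ (Cx k)))//.
  rewrite lerBrDr (@le_trans _ _ ((Num.bound `|M|).+1%:R))// ?ler_nat//.
  rewrite -natr1 lerD2r (le_trans (ler_norm _))//.
  by rewrite ltW// archi_boundP.
pose K := 0 |` [set F nk.1 nk.2 | nk in
  [set nk : nat * nat | (nk.2 < nk.1 ^ 2)%N]].
have cK : compact K.
  apply: (@compact_cofinite_nbhs _ K 0); first by left.
  move=> U U0; have [N NU] := FU U U0.
  apply: (@sub_finite_set _ _
    ((fun nk => F nk.1 nk.2) @` (`I_N `*` `I_(N ^ 2)))).
    move=> _ [[->|[[n k] /= kn <-]] nU]; first by have := nbhs_singleton U0.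
    have nN : (n < N)%N by rewrite ltnNge; apply/negP => /NU.
    exists (n, k) => //; split => //=.
    by rewrite (leq_trans kn)// leq_exp2r// ltnW.
  exact/finite_image/finite_setX.
have [U [V [U0 V0 UV]]] := asc K cK (0 : Ck R X) 0 (ball 0 1)
  (or_introl erefl) (nbhsx_ballx (0 : R) 1 ltr01).
have [N NU] := FU U U0.
have [n [k [Nn kn Vnk]]] := weak_peaks_cluster N e0 e1 V0.
have Fne : Ck_fun (F n k) (n%:R *: e k : Ck R X) = 1.
  by rewrite mkCkE Ck_funZ ex mulr1 opprB addrCA subrr addr0 max_r.
have := UV (F n k) _ (or_intror (ex_intro2 _ _ (n, k) kn erefl))
  (NU n k Nn) Vnk.
by rewrite Fne /ball/= sub0r normrN normr1 ltxx.
Qed.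

End weak_ascoli.

(** * Consequences of completeness and metrizability *)

Section frechet.
Variables (R : realType) (X : topologicalType).
Hypothesis tychX : tychonoff_space X.

Lemma complete_compact_finite_discrete :
  tvs_complete (Ck R X) -> (forall C : set X, compact C -> finite_set C) ->
  discrete_space X.
Proof.
move=> compl finC.
suff open1 (a : X) : open [set a].
  move=> A; have -> : A = \bigcup_(a in A) [set a].
    by rewrite bigcup_imset1 image_id.
  by apply: bigcup_open => a _.
(* the sets of continuous functions that coincide with the indicator function
   of [a] on a compact, hence finite, set generate a Cauchy filter *)
pose P (C : set X) := [set f : Ck R X | forall x, C x -> f x = (x == a)%:R].
pose F := filter_from compact P.
have FF : ProperFilter F.
  apply: filter_from_proper; first apply: filter_from_filter.
  - by exists set0; exact: compact0.
  - move=> C D cC cD; exists (C `|` D); first exact: compactU.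
    by move=> f fP; split => x ?; apply: fP; [left|right].
  move=> C cC; have [f [fa f0 _]] := @tychonoff_separation R X tychX a (C `\ a)
    (tychonoff_finite_closed tychX (finite_setD _ (finC C cC)))
    (fun h => h.2 erefl).
  exists f => x Cx; have [->//|/eqP xa] := eqVneq x a.
  exact: f0.
have cauF : tvs_cauchy F.
  move=> U /nbhs_CkP[C [d [cC d0 CU]]]; exists (P C); first by exists C.
  move=> f g fP gP; apply: CU => x Cx.
  by rewrite Ck_fun0 Ck_funB fP// gP// subrr subrr normr0.
have [f Ff] := compl F FF cauF.
have fE x : Ck_fun f x = (x == a)%:R.
  apply/eqP; rewrite -subr_eq0 -normr_le0; apply/ler_addgt0Pr => d d0.
  rewrite add0r.
  have [|C cC CP] :=
      Ff [set g : Ck R X | forall y, [set x] y -> `|f y - g y| < d].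
    by apply/nbhs_CkP; exists [set x], d; split => //; exact: compact_set1.
  have [g [gC gx]] : (P C `&` P [set x]) !=set0.
    apply: (@filter_ex _ F); apply: filterI; first by exists C.
    by exists [set x] => //; exact: compact_set1.
  by have := CP g gC x erefl; rewrite gx// => /ltW.
have -> : [set a] = Ck_fun f @^-1` [set r | 0 < r].
  apply/seteqP; split => [x -> /=|x /=]; rewrite fE ?eqxx//.
  by case: eqVneq => //; rewrite ltxx.
apply: open_comp; last exact: open_gt.
by move=> x _; exact: Ck_continuous.
Qed.

Lemma metrizable_compact_finite_countable :
  metrizable_space R (Ck R X) ->
  (forall C : set X, compact C -> finite_set C) ->
  countable [set: X].
Proof.
move=> /metrizable_first_countable-/(_ (0 : Ck R X))[V [V0 VU]] finC.
have /choice[C CP] n : exists C : set X, compact C /\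
    forall f : Ck R X, (forall x, C x -> f x = 0) -> V n f.
  have /nbhs_CkP[C [d [cC d0 CV]]] := V0 n; exists C; split => // f f0.
  by apply: CV => x Cx; rewrite Ck_fun0 f0// subrr normr0.
apply: (@sub_countable _ _ _ (\bigcup_n C n)); last first.
  apply: bigcup_countable => // n _; apply: finite_set_countable.
  by apply: finC; have [] := CP n.
(* a point [a] outside all the [C n] would be separated from each of them, so
   that no [V n] would force functions to be small at [a] *)
apply: subset_card_le => a _; apply: contrapT => nCa.
have [|N NU] :=
    VU [set f : Ck R X | forall y, [set a] y -> `|Ck_fun 0 y - f y| < 1].
  by apply/nbhs_CkP; exists [set a], 1; split => //; exact: compact_set1.
have [f [fa f0 _]] := @tychonoff_separation R X tychX a (C N)
  (tychonoff_finite_closed tychX (finC _ (CP N).1))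
  (fun CNa => nCa (ex_intro2 _ _ N I CNa)).
have := NU N (leqnn N) f ((CP N).2 f f0) a erefl.
by rewrite Ck_fun0 fa sub0r normrN normr1 ltxx.
Qed.

End frechet.

(** * Discrete spaces *)

Section discrete.
Variables (R : realType) (X : topologicalType).

Lemma discrete_weak_nbhsE : discrete_space X ->
  forall f : Ck R X, nbhs (f : weak_space (Ck R X)) = nbhs f.
Proof.
move=> discX f; apply/seteqP; split => A.
  have [_ weakf] := @weak_cvgP _ _ (nbhs f) f (nbhs_filter f).
  by apply: weakf => -[phi cphi]; exact: cphi.
move=> /nbhs_CkP[C [d [cC d0 CA]]].
have /finite_fsetP[D CD] := discrete_compact_finite discX cC.
have evf (x : X) : nbhs (f : weak_space (Ck R X))
    [set g : Ck R X | `|Ck_fun f x - Ck_fun g x| < d].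
  have := @weak_evaluation_continuous R X x f (ball (Ck_fun f x) d).
  by apply; exact: nbhsx_ballx.
have := @filter_bigI _ _ D _ _ (nbhs_filter (f : weak_space (Ck R X)))
  (fun x _ => evf x).
apply: filterS => g gD; apply: CA => x Cx; apply: gD.
by rewrite -CD.
Qed.

Lemma discrete_metrizable_weak_ascoli :
  discrete_space X -> metrizable_space R (Ck R X) ->
  ascoli_space R (weak_space (Ck R X)).
Proof.
move=> discX metX; have wE := discrete_weak_nbhsE discX.
split; last first.
  move=> K; apply: first_countable_evenly_continuous => z.
  have := metrizable_first_countable (z : Ck R X) metX.
  by rewrite -wE.
split => [f B cB nBf|f g fg].
  have cB' : @closed (Ck R X) B.
    by move=> g clg; apply: cB => A; rewrite wE; exact: clg.
  have [uT [E [entE fBE sub]]] := @point_uniform_separator R _ _ _ cB' nBf.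
  by exists uT, E; split => // g; rewrite wE; exact: sub.
have [mT nbhsE] := metX; apply: (@metric_hausdorff R (Metric.Pack mT)) => A B.
by rewrite !nbhsE -!wE; exact: fg.
Qed.

End discrete.

Theorem corollary1p7 (R : realType) (X : topologicalType) :
  tychonoff_space X -> frechet_space (Ck R X) ->
  (ascoli_space R (weak_space (Ck R X)) <->
   countable [set: X]%classic /\ discrete_space X).
Proof.
move=> tychX [metX compX]; split=> [asc|[_ discX]].
  have finC := weak_ascoli_compact_finite tychX asc.
  split; first exact: metrizable_compact_finite_countable tychX metX finC.
  exact: complete_compact_finite_discrete tychX compX finC.
exact: discrete_metrizable_weak_ascoli.
Qed.
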